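(* Let $X_n$, $A_n$, $B_n$ denote the numbers of occupied seats at the end of the random unfriendly seating process started from the empty seat configurations $\mathscr{X}_n$, $\mathscr{A}_n$, $\mathscr{B}_n$, respectively. For every $n\ge1$, the following stochastic dominance relations hold: \[ A_{n+1}\ge X_n,\qquad B_{n+1}\ge X_n,\qquad X_n\ge A_{n-1}-2,\qquad X_n\ge B_{n-1}-2, \] where, for random variables, $X\ge Y$ (in distribution) means that $\mathbb{P}(X\le x)\le\mathbb{P}(Y\le x)$ for all $x$.
   Context: A seat configuration is a finite set $S$ of seats $(r,c)$ with row $r\in\{\text{top},\text{bottom}\}$ and column $c\in\mathbb{Z}$. Two seats are neighbors if they lie in the same row in consecutive columns, or in the same column in opposite rows. The random unfriendly seating process started from $S$: at each step, a seat is chosen uniformly at random among the currently available seats (initially all seats of $S$ are available); it becomes occupied, and it together with all its neighbors in $S$ becomes unavailable; choices are made until no seat is available. The configurations are: - $\mathscr{X}_n$ ($n\ge1$, $2n$ seats): both rows have columns $1,\dots,n$. - $\mathscr{A}_n$ ($n\ge1$, $2n$ seats): the top row has columns $1,\dots,n$ and the bottom row has columns $2,\dots,n+1$; $\mathscr{A}_0=\varnothing$, so $A_0=0$. - $\mathscr{B}_n$ ($n\ge1$, $2n$ seats): the top row has columns $1,\dots,n-1$ and the bottom row has columns $0,1,\dots,n$; $\mathscr{B}_0$ is a single seat, so $B_0=1$. *)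

(* Defs.v *)
From mathcomp Require Import all_boot all_order all_algebra finmap.

Set Implicit Arguments.
Unset Strict Implicit.
Unset Printing Implicit Defensive.

Import Order.TTheory GRing.Theory Num.Theory.

Local Open Scope ring_scope.
Local Open Scope fset_scope.

Definition seat : Type := (bool * int)%type.
Definition top : bool := true.
Definition bottom : bool := false.

Definition neighbor : rel seat := fun s t =>
  ((s.1 == t.1) && (`|s.2 - t.2| == 1)) || ((s.1 != t.1) && (s.2 == t.2)).

(* Seats of the row r in columns a, ..., b; none if b < a. *)
Definition row_seats (r : bool) (a b : nat) : {fset seat} :=
  [fset (r, c%:Z) | c in index_iota a b.+1].

Definition confX (n : nat) : {fset seat} :=
  row_seats top 1 n `|` row_seats bottom 1 n.

Definition confA (n : nat) : {fset seat} :=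
  row_seats top 1 n `|` row_seats bottom 2 n.+1.

(* For n = 0 this is the single seat (bottom, 0). *)
Definition confB (n : nat) : {fset seat} :=
  row_seats top 1 n.-1 `|` row_seats bottom 0 n.

(* A random variable carried by some finite probability space. *)
Record finRV (R : realFieldType) := FinRV {
  space : finType;
  prob : {ffun space -> R};
  value : space -> R;
  prob_ge0 : forall w, 0 <= prob w;
  prob_sum1 : \sum_w prob w = 1
}.

Arguments value {R} _ _.
Arguments prob_ge0 {R} _ _.

Definition cdf (R : realFieldType) (X : finRV R) (x : R) : R :=
  \sum_(w | value X w <= x) prob X w.

Definition subc (R : realFieldType) (X : finRV R) (a : R) : finRV R :=
  @FinRV R (space X) (prob X) (fun w => value X w - a)
    (prob_ge0 X) (prob_sum1 X).

Definition dominates (R : realFieldType) (X Y : finRV R) : Prop :=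
  forall x : R, cdf X x <= cdf Y x.

Section Process.
Variables (R : realFieldType) (T : finType) (nb : rel T).

(* A state (O, A): set of occupied seats, set of available seats. *)
Local Notation state := ({set T} * {set T})%type.

Definition start : state := (set0, setT).

Definition occupy (w : state) (s : T) : state :=
  (s |: w.1, w.2 :\: [set t | (t == s) || nb s t])%SET.

(* Markov kernel; states without available seats are absorbing. *)
Definition step (w w' : state) : R :=
  if w.2 == set0 then (w' == w)%:R
  else \sum_(s in w.2) #|w.2|%:R^-1 * (w' == occupy w s)%:R.

Fixpoint law (k : nat) : {ffun state -> R} :=
  if k is k'.+1 then [ffun w' => \sum_w law k' w * step w w']
  else [ffun w => (w == start)%:R].

Lemma step_ge0 w w' : 0 <= step w w'.
Proof.
rewrite /step; case: ifP => _; first exact: ler0n.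
by apply: sumr_ge0 => s _; rewrite mulr_ge0 ?invr_ge0 ?ler0n.
Qed.

Lemma sum_eqnat (v : state) : \sum_w (w == v)%:R = 1 :> R.
Proof. by rewrite (bigD1 v) //= eqxx big1 ?addr0 // => w /negPf ->. Qed.

Lemma step_sum1 w : \sum_w' step w w' = 1.
Proof.
rewrite /step; case: (_ == set0) / boolP => [_|w2]; first exact: sum_eqnat.
rewrite exchange_big /= (eq_bigr (fun=> #|w.2|%:R^-1)) => [|s _]; last first.
  by rewrite -mulr_sumr sum_eqnat mulr1.
rewrite sumr_const -[LHS]mulr_natl divff // pnatr_eq0.
by rewrite cards_eq0.
Qed.

Lemma law_ge0 k w : 0 <= law k w.
Proof.
elim: k w => [|k IHk] w /=; rewrite ffunE ?ler0n //.
by apply: sumr_ge0 => v _; rewrite mulr_ge0 ?step_ge0.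
Qed.

Lemma law_sum1 k : \sum_w law k w = 1.
Proof.
elim: k => [|k IHk] /=.
  by rewrite -[RHS](sum_eqnat start); apply: eq_bigr => w _; rewrite ffunE.
rewrite (eq_bigr (fun w' => \sum_w law k w * step w w')) => [|w' _];
  last by rewrite ffunE.
rewrite exchange_big /= -[RHS]IHk.
by apply: eq_bigr => w _; rewrite -mulr_sumr step_sum1 mulr1.
Qed.

Lemma law_avail k w : law k w != 0 -> (#|w.2| <= #|T| - k)%N.
Proof.
elim: k w => [|k IHk] w /=; first by rewrite subn0 max_card.
rewrite ffunE => nz.
have [v] : exists v, law k v * step v w != 0.
  apply/existsP; apply: contraNT nz; rewrite negb_exists => /forallP h.
  by rewrite big1 // => v _; apply/eqP; move: (h v); rewrite negbK.
rewrite mulf_eq0 negb_or => /andP[/IHk lev].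
rewrite /step; case: ifPn => [/eqP v0|_].
  by case: (eqVneq w v) => [->|_]; rewrite ?eqxx // v0 cards0.
move=> nz2.
have [s sv /eqP ->] : exists2 s, s \in v.2 & w == occupy v s.
  apply/exists_inP; apply: contraNT nz2 => /exists_inPn h.
  by rewrite big1 // => s /h /negPf ->; rewrite mulr0.
suff /leq_trans/(_ lev) : (#|(occupy v s).2| < #|v.2|)%N.
  by rewrite subnS; case: (_ - k)%N.
apply: proper_card; apply/properP.
by split; [exact: subsetDl | exists s => //; rewrite !inE eqxx].
Qed.

(* Each step uses up an available seat, so after #|T| steps the process has
   stopped. *)
Lemma law_final w : law #|T| w != 0 -> w.2 = set0.
Proof. by move=> /law_avail; rewrite subnn leqn0 cards_eq0 => /eqP. Qed.

Definition occupied_count : finRV R :=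
  @FinRV R _ (law #|T|) (fun w : state => #|w.1|%:R) (law_ge0 _) (law_sum1 _).

End Process.

Definition occupied (R : realFieldType) (S : {fset seat}) : finRV R :=
  occupied_count R (fun s t : S => neighbor (val s) (val t)).

Definition X_ (R : realFieldType) (n : nat) : finRV R := occupied R (confX n).
Definition A_ (R : realFieldType) (n : nat) : finRV R := occupied R (confA n).
Definition B_ (R : realFieldType) (n : nat) : finRV R := occupied R (confB n).

(* Main.v *)
Require Import Defs.
From mathcomp Require Import all_boot all_order all_algebra finmap zify.

(** Each of the four comparisons is between two configurations one of which is,
up to a translation, the other with one seat added at each end.  Everything
reduces to adding one seat [v] in the first (or, by reflection, the last)
column of a configuration [S]: the number of occupied seats then decreases by
at most one, and not at all when the seat opposite to [v] is missing from [S]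
([dominates_add_first], [dominates_add_last]).  For [A_n+1] and [B_n+1] over
[X_n] the added seats have no opposite seat, so nothing is lost; for [X_n] over
[A_n-1] and [B_n-1] each of the two added seats costs at most one.

The one-seat comparison holds pathwise.  Choosing uniformly among the available
seats amounts to drawing all the seats in a uniformly random order and
occupying each one that is still available when it is drawn
([tail_cdf_order]), so the processes on [v |` S] and on [S] can be run with
the same order ([order_cdf_dominates]).  Let [O] and [O'] be their final sets of
occupied seats and let [D] be the symmetric difference of [O] and [O'].  A seat
other than [v] can enter [D] only because one of its neighbors is already in
[D], on the other side of the difference.  Two consequences ([alternating]):

- the seats of [D] that lie in [O] are those which have the color of [v] in
  the checkerboard coloring of the ladder;
- the columns that meet [D] form an interval that starts at the column of [v].

A column of the ladder has one seat of each color, so it contributes at most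
one to each of [O `\` O'] and [O' `\` O].  Suppose that [m] is in [O' `\` O]
while the opposite seat is not in [O `\` O'].  Then the opposite seat is in
neither set.  Being unoccupied, it is blocked in [O] by some [q], whose color is
not that of [v], so that [q] is in both sets; but then no seat in the column
of [q] is in [D].  That column is at most one past the column of [m], so [D]
stops at the column of [m] ([alternating_last]).  Hence there is at most one
such [m], in the last column of [D], and it is compensated by [v] itself
when the column of [v] has no other seat ([card_alternating]). *)

Set Implicit Arguments.
Unset Strict Implicit.
Unset Printing Implicit Defensive.

Import Order.TTheory GRing.Theory Num.Theory.

Local Open Scope fset_scope.
Local Open Scope ring_scope.

Implicit Types (S O A U : {fset seat}).

(** * The final count as a recursion over sets of seats *)

Lemma neighborC (s t : seat) : neighbor s t = neighbor t s.
Proof. by rewrite /neighbor ![t.1 == _]eq_sym ![t.2 == _]eq_sym distrC. Qed.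

Definition vacate A (s : seat) : {fset seat} := [fset t in A | (t != s) && ~~ neighbor s t].

(** The probability that the final count is at most [x], given that [O] is
occupied and [A] is available, with [k] a bound on the remaining steps. *)
Fixpoint tail_cdf (R : realFieldType) (k : nat) (x : R) O A : R :=
  if k is k'.+1 then
    if A == fset0 then (#|` O|%:R <= x)%R%:R
    else \sum_(s <- A) #|` A|%:R^-1 * tail_cdf k' x (s |` O) (vacate A s)
  else (#|` O|%:R <= x)%R%:R.

(** The configurations live on different finite types, so the process is
transported to sets of seats along an arbitrary embedding [e].  Leaving [e] free
yields invariance under the symmetries of the ladder at no extra cost. *)
Section FinalCount.
Variables (R : realFieldType) (T : finType) (nb : rel T) (e : T -> seat).
Hypotheses (e_inj : injective e) (e_mono : {mono e : s t / nb s t >-> neighbor s t}).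
Local Notation state := ({set T} * {set T})%type.
Implicit Types (g : state -> R) (w : state) (s t : T).

Definition push g : state -> R := fun w => \sum_w' step R nb w w' * g w'.

(** The law is defined by pushing forward from the start; expectations can instead
be computed by first-step analysis. *)
Lemma law_push k g :
  \sum_w law R nb k w * g w = iter k push g (start T).
Proof.
elim: k g => [|k IHk] g /=.
  rewrite (bigD1 (start T)) //= ffunE eqxx mul1r big1 ?addr0 // => w /negPf nw.
  by rewrite ffunE nw mul0r.
rewrite -iterS iterSr -IHk.
under eq_bigr do rewrite ffunE mulr_suml.
rewrite exchange_big /=; apply: eq_bigr => w _; rewrite mulr_sumr.
by apply: eq_bigr => w' _; rewrite mulrA.
Qed.

Lemma pushE g w : push g w =
  if w.2 == set0 then g w
  else \sum_(s in w.2) #|w.2|%:R^-1 * g (occupy nb w s).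
Proof.
have delta w0 : \sum_w' (w' == w0)%:R * g w' = g w0.
  rewrite (bigD1 w0) //= eqxx mul1r big1 ?addr0 // => w' /negPf ->.
  by rewrite mul0r.
rewrite /push /step; case: ifP => _; first exact: delta.
under eq_bigr do rewrite mulr_suml.
rewrite exchange_big /=; apply: eq_bigr => s _.
by under eq_bigr do rewrite -mulrA; rewrite -mulr_sumr delta.
Qed.

Definition seats_of (B : {set T}) : {fset seat} := [fset e t | t in B].

Lemma card_seats_of B : #|` seats_of B| = #|B|.
Proof. by rewrite card_imfset //= -cardE. Qed.

Lemma mem_seats_of B t : (e t \in seats_of B) = (t \in B).
Proof. by rewrite mem_imfset. Qed.

Lemma seats_of_occupy1 (O : {set T}) s : seats_of (s |: O)%SET = e s |` seats_of O.
Proof.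
apply/fsetP => t; rewrite !inE; apply/imfsetP/orP => /=.
  move=> [u]; rewrite !inE => /orP[/eqP ->|uO] ->; first by left.
  by right; rewrite mem_seats_of.
move=> [/eqP ->|/imfsetP[u /= uO ->]]; first by exists s; rewrite ?inE ?eqxx.
by exists u; rewrite ?inE ?uO ?orbT.
Qed.

Lemma seats_of_vacate (A : {set T}) s :
  seats_of (A :\: [set t | (t == s) || nb s t])%SET = vacate (seats_of A) (e s).
Proof.
apply/fsetP => t; apply/imfsetP/idP => /= [[u]|].
  rewrite !inE negb_or => /andP[/andP[us nus] uA] ->.
  by rewrite mem_seats_of uA (inj_eq e_inj) us e_mono.
rewrite !inE /= => /andP[/imfsetP[u /= uA ->]].
rewrite (inj_eq e_inj) e_mono => /andP[us nus].
by exists u; rewrite ?inE ?negb_or ?us ?nus.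
Qed.

Lemma iter_push k (x : R) w :
  iter k push (fun w => (#|w.1|%:R <= x)%R%:R) w =
  tail_cdf k x (seats_of w.1) (seats_of w.2).
Proof.
elim: k w => [|k IHk] w /=; first by rewrite card_seats_of.
rewrite pushE -cardfs_eq0 card_seats_of cards_eq0 card_seats_of.
case: ifP => [/eqP w2|_].
  rewrite IHk; case: (k) => [|k'] /=; rewrite ?card_seats_of //.
  by rewrite w2 -cardfs_eq0 card_seats_of cards0.
rewrite big_imfset /=; last by move=> ? ? _ _; apply: e_inj.
rewrite big_enum /=; apply: eq_bigr => s sw.
by rewrite IHk seats_of_occupy1 seats_of_vacate.
Qed.

Lemma cdf_occupied_count x :
  cdf (occupied_count R nb) x = tail_cdf #|T| x fset0 (seats_of setT).
Proof.
rewrite /cdf big_mkcond /=.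
have -> : fset0 = seats_of (set0 : {set T}).
  by apply/esym/eqP; rewrite -cardfs_eq0 card_seats_of cards0.
rewrite -(iter_push _ _ (start T)) -law_push; apply: eq_bigr => w _.
by case: ifP; rewrite ?mulr1 ?mulr0.
Qed.
End FinalCount.

Implicit Types (d m s t v : seat).

Lemma cdf_occupied (R : realFieldType) S (f : seat -> seat) x :
  injective f -> {mono f : s t / neighbor s t} ->
  cdf (occupied R S) x = tail_cdf #|` S| x fset0 [fset f s | s in S].
Proof.
move=> f_inj f_mono; rewrite /occupied.
rewrite (@cdf_occupied_count _ _ _ (fun s : S => f (val s))); first last.
- by move=> s t; rewrite f_mono.
- by move=> s t /f_inj /val_inj.
rewrite -cardfE; congr tail_cdf; apply/fsetP => t.
apply/imfsetP/imfsetP => /= [[s _ ->]|[s sS ->]]; first by exists (val s); rewrite ?fsvalP.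
by exists [` sS].
Qed.

Lemma cdf_occupied_isometry (R : realFieldType) S (f : seat -> seat) x :
  injective f -> {mono f : s t / neighbor s t} ->
  cdf (occupied R [fset f s | s in S]) x = cdf (occupied R S) x.
Proof.
move=> f_inj f_mono; rewrite [RHS](@cdf_occupied _ _ f) //.
rewrite (@cdf_occupied _ _ id) //; congr tail_cdf; last by rewrite imfset_id.
by rewrite card_imfset.
Qed.

(** * Drawing the seats in a random order *)

Definition blocked O s : bool := [exists t : O, neighbor (val t) s].

Definition seat_if_free S O s : {fset seat} :=
  if (s \in S) && ~~ blocked O s then s |` O else O.

(** The analogue of [tail_cdf] when every seat of [U], available or not, is
drawn in turn, in uniformly random order.  [U] need not be contained in
[S], which lets two configurations share the same order. *)
Fixpoint order_cdf (R : realFieldType) S (k : nat) (x : R) O U : R :=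
  if k is k'.+1 then
    \sum_(s <- U) #|` U|%:R^-1 * order_cdf S k' x (seat_if_free S O s) (U `\ s)
  else (#|` O|%:R <= x)%R%:R.

Lemma order_cdfS (R : realFieldType) S k (x : R) O U :
  order_cdf S k.+1 x O U =
  \sum_(s <- U) #|` U|%:R^-1 * order_cdf S k x (seat_if_free S O s) (U `\ s).
Proof. by []. Qed.

Definition avail S O U : {fset seat} := [fset s in U | (s \in S) && ~~ blocked O s].

Lemma blockedP O s : reflect (exists2 t, t \in O & neighbor t s) (blocked O s).
Proof.
apply: (iffP existsP) => [[t nts]|[t tO nts]]; first by exists (val t); rewrite ?fsvalP.
by exists [` tO].
Qed.

Lemma blockedU1 O s t : blocked (s |` O) t = neighbor s t || blocked O t.
Proof.
apply/blockedP/orP => [[u]|[nst|/blockedP[u uO nut]]].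
- by rewrite !inE => /orP[/eqP ->|uO] nut; [left | right; apply/blockedP; exists u].
- by exists s; rewrite ?inE ?eqxx.
- by exists u; rewrite ?inE ?uO ?orbT.
Qed.

(** Drawing an unavailable seat changes nothing, and conditionally on the next
draw being available it is uniform among the available seats. *)
Lemma tail_cdf_order (R : realFieldType) S k (x : R) O U : (#|` U| <= k)%N ->
  tail_cdf k x O (avail S O U) = order_cdf S #|` U| x O U.
Proof.
move: {2}#|` U| (erefl #|` U|) => n; elim: n k O U => [|n IHn] k O U cU leUk.
  have U0 := cardfs0_eq cU; rewrite cU /=.
  have -> : avail S O U = fset0 by apply/fsetP => s; rewrite !inE U0.
  by case: k {leUk} => //= k; rewrite eqxx.
have cD s : s \in U -> #|` U `\ s| = n.
  by move=> sU; have := cardfsD1 s U; rewrite sU cU add1n => -[<-].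
case: k leUk => [|k]; rewrite cU // => leUk.
have U0 : #|` U|%:R != 0 :> R by rewrite pnatr_eq0 cU.
set A := avail S O U.
have A_U : A `<=` U by apply/fsubsetP => s; rewrite !inE => /andP[].
(* First-step analysis for the random order, by the induction hypothesis. *)
have -> : order_cdf S n.+1 x O U =
   \sum_(s <- U) #|` U|%:R^-1 * (if s \in A then tail_cdf k x (s |` O) (vacate A s)
                              else tail_cdf k.+1 x O A).
  rewrite order_cdfS; apply: eq_fbigr => s sU _; congr (_ * _).
  have -> : (s \in A) = (s \in S) && ~~ blocked O s by rewrite !inE /= sU.
  rewrite -[n in LHS](cD s sU) /seat_if_free.
  case: ifP => [/andP[sS nbs]|nA].
    rewrite -(IHn k _ _ (cD s sU)) ?(cD s sU) //.
    congr tail_cdf; apply/fsetP => t; rewrite !inE /= blockedU1 negb_or.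
    by rewrite -!andbA; do !bool_congr.
  rewrite -(IHn k.+1 _ _ (cD s sU)) ?(cD s sU) 1?ltnW //.
  congr tail_cdf; apply/fsetP => t; rewrite !inE /=.
  by case: eqP => //= ->; rewrite nA andbF.
rewrite -mulr_sumr (big_fsetID _ (mem A)) /=.
have -> : [fset s in U | s \in A] = A by apply/fsetP => s; rewrite !inE /=; case: (s \in U).
(* The available seats contribute [#|A|] times the value, by definition of
   [tail_cdf]; each of the other seats contributes the value itself. *)
apply: (mulfI U0); rewrite mulrA divff // mul1r.
have -> : \sum_(s <- A) (if s \in A then tail_cdf k x (s |` O) (vacate A s)
   else tail_cdf k.+1 x O A) = #|` A|%:R * tail_cdf k.+1 x O A.
  have [A0|A0] := eqVneq A fset0; first by rewrite A0 big_seq_fset0 cardfs0 mul0r.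
  rewrite /= (negPf A0) -mulr_sumr mulrA divff ?mul1r; last by rewrite pnatr_eq0 cardfs_eq0.
  by apply: eq_fbigr => s ->.
have -> : [fset s in U | s \notin A] = U `\` A by apply/fsetP => s; rewrite !inE /= andbC.
have -> : \sum_(s <- U `\` A) (if s \in A then tail_cdf k x (s |` O) (vacate A s)
   else tail_cdf k.+1 x O A) = \sum_(s <- U `\` A) tail_cdf k.+1 x O A.
  by apply: eq_fbigr => s; rewrite inE => /andP[/negPf ->].
rewrite big_const_seq iter_addr_0 count_predT -[X in (_ + X)%R]mulr_natl -mulrDl -natrD.
by rewrite cardfsDS // subnKC // fsubset_leq_card.
Qed.

(** The number [k] of steps in [tail_cdf] is immaterial once it is large enough, so
seats outside of [S] may take part in the order. *)
Lemma cdf_occupied_order (R : realFieldType) S U (x : R) : S `<=` U ->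
  cdf (occupied R S) x = order_cdf S #|` U| x fset0 U.
Proof.
move=> sSU.
have free0 U' : S `<=` U' -> avail S fset0 U' = S.
  move=> /fsubsetP sSV; apply/fsetP => s; rewrite !inE /=.
  have -> : blocked fset0 s = false by apply/blockedP => -[].
  by rewrite andbT; case: (boolP (s \in S)) => [/sSV ->|]; rewrite ?andbF.
have fuel k : (#|` S| <= k)%N -> tail_cdf k x fset0 S = order_cdf S #|` S| x fset0 S.
  by move=> leSk; rewrite -(tail_cdf_order _ _ _ leSk) free0.
rewrite (@cdf_occupied _ _ id) // imfset_id fuel // -(fuel #|` U|) ?fsubset_leq_card //.
by rewrite -[in LHS](free0 U sSU) tail_cdf_order.
Qed.

(** Two processes driven by the same order: an invariant that bounds the final counts
on every path gives stochastic dominance. *)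
Lemma order_cdf_dominates (R : realFieldType) S S' b (x : R)
    (Inv : {fset seat} -> {fset seat} -> {fset seat} -> Prop) O O' U :
  (forall O O' U s, Inv O O' U -> s \in U ->
     Inv (seat_if_free S O s) (seat_if_free S' O' s) (U `\ s)) ->
  (forall O O', Inv O O' fset0 -> (#|` O'| <= #|` O| + b)%N) ->
  Inv O O' U ->
  order_cdf S #|` U| x O U <= order_cdf S' #|` U| (x + b%:R) O' U.
Proof.
move=> Inv_step Inv_end; move: {2}#|` U| (erefl #|` U|) => n.
elim: n O O' U => [|n IHn] O O' U cU inv.
  rewrite cU /=; move: inv; rewrite (cardfs0_eq cU) => /Inv_end le_b.
  rewrite ler_nat; case: (boolP (#|` O|%:R <= x)%R) => //= leOx.
  have -> // : (#|` O'|%:R <= x + b%:R)%R.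
  by rewrite (le_trans (y := #|` O|%:R + b%:R)%R) // ?lerD2r // -natrD ler_nat.
rewrite cU !order_cdfS [X in X <= _]big_seq [X in _ <= X]big_seq; apply: ler_sum => s sU.
have cD : #|` U `\ s| = n by have := cardfsD1 s U; rewrite sU cU add1n => -[<-].
rewrite ler_wpM2l ?invr_ge0 ?ler0n // -{2}cD.
by move: (IHn _ _ _ cD (Inv_step _ _ _ _ inv sU)); rewrite cD.
Qed.

(** * Adding a seat at an end of the ladder *)

(** The state of the process on [S] when [U] is the set of seats not drawn yet; for
empty [U], [O] is a maximal independent set of [S]. *)
Record greedy S U O : Prop := Greedy {
  greedy_sub : {subset O <= S};
  greedy_drawn : forall s, s \in O -> s \notin U;
  greedy_indep : forall s t, s \in O -> t \in O -> ~~ neighbor s t;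
  greedy_max : forall s, s \in S -> s \notin U -> (s \in O) || blocked O s
}.

Lemma neighbor_irr s : ~~ neighbor s s.
Proof. by rewrite /neighbor !eqxx subrr. Qed.

Lemma greedy_start S U : S `<=` U -> greedy S U fset0.
Proof. by move=> /fsubsetP sSU; split=> // s /sSU ->. Qed.

Lemma greedy_step S U O s : greedy S U O -> s \in U ->
  greedy S (U `\ s) (seat_if_free S O s).
Proof.
move=> [O_S O_U indep maxi] sU; rewrite /seat_if_free.
case: ifP => [/andP[sS nbs]|].
  have nOs t : t \in O -> ~~ neighbor t s.
    by move=> tO; apply: contra nbs => nts; apply/blockedP; exists t.
  split=> [t|t|t u|t tS]; rewrite ?inE.
  - by move=> /orP[/eqP ->|/O_S].
  - by move=> /orP[->|/O_U /negPf ->] //; rewrite andbF.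
  - move=> /orP[/eqP ->|tO] /orP[/eqP ->|uO].
    + exact: neighbor_irr.
    + by rewrite neighborC nOs.
    + exact: nOs.
    + exact: indep.
  - rewrite blockedU1; case: (eqVneq t s) => //= _ /(maxi _ tS).
    by case: (t \in O) => //= ->; rewrite orbT.
move=> nfree; split=> [//|t tO|//|t tS]; rewrite ?inE.
- by rewrite negb_and O_U // orbT.
- case: (eqVneq t s) tS => [->|_] tS /=; last exact: maxi.
  by move: nfree; rewrite tS; case: blocked; rewrite ?orbT.
Qed.

Definition opposite s : seat := (~~ s.1, s.2).

(** The checkerboard coloring of the ladder. *)
Definition color s : bool := s.1 (+) odd `|s.2|%N.

Lemma oppositeK : involutive opposite.
Proof. by case=> r c; rewrite /opposite /= negbK. Qed.

Lemma neighbor_opposite s : neighbor s (opposite s).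
Proof. by rewrite /neighbor /= eqxx; case: s.1; rewrite orbT. Qed.

Lemma same_column s t : s.2 = t.2 -> s = t \/ s = opposite t.
Proof.
case: s t => [r c] [r' c'] /= ->; rewrite /opposite /=.
by case: r r' => -[]; [left|right|right|left].
Qed.

Lemma neighbor_color s t : neighbor s t -> color s = ~~ color t.
Proof.
case: s t => [r c] [r' c']; rewrite /neighbor /color /=.
case/orP=> [/andP[/eqP -> cc']|/andP[rr' /eqP ->]]; last first.
  by case: r r' rr' => -[] //= _; rewrite negbK.
have : odd `|c|%N != odd `|c'|%N by lia.
by case: r'; case: (odd `|c|%N); case: (odd `|c'|%N).
Qed.

Lemma neighbor_column s t : neighbor s t -> s.2 <= t.2 + 1.
Proof. by rewrite /neighbor; lia. Qed.

(** The discrepancy between the processes on [v |` S] and [S].  It spreads from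
[v] through chains of neighbors whose members lie alternately in [O] and in
[O'], which fixes their colors and leaves no gap between columns. *)
Record alternating v O O' : Prop := Alternating {
  alt_color : forall s, (s \in O) (+) (s \in O') -> (color s == color v) = (s \in O);
  alt_columns : forall s c, (s \in O) (+) (s \in O') -> v.2 <= c <= s.2 ->
    exists2 t : seat, (t \in O) (+) (t \in O') & t.2 = c
}.

Lemma alternating_start v O : alternating v O O.
Proof. by split=> s; rewrite addbb. Qed.

(** If the two processes treat [s] differently, then either [s] is [v], or [s] is
blocked in just one of them, by a neighbor where they already differ. *)
Lemma alternating_step v S U O O' s :
    greedy (v |` S) U O -> greedy S U O' -> alternating v O O' -> s \in U ->
  alternating v (seat_if_free (v |` S) O s) (seat_if_free S O' s).
Proof.
move=> gO gO' [colorD columnsD] sU.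
have sO : s \in O = false by apply: contraTF sU => /(greedy_drawn gO).
have sO' : s \in O' = false by apply: contraTF sU => /(greedy_drawn gO').
set P := seat_if_free _ _ _; set P' := seat_if_free _ _ _.
have PE t : t \in P = if t == s then (s \in v |` S) && ~~ blocked O s else t \in O.
  rewrite /P /seat_if_free; case: ifP => _; rewrite ?inE; case: eqP => //= ->.
  by rewrite sO.
have P'E t : t \in P' = if t == s then (s \in S) && ~~ blocked O' s else t \in O'.
  rewrite /P' /seat_if_free; case: ifP => _; rewrite ?inE; case: eqP => //= ->.
  by rewrite sO'.
have new : (s \in P) (+) (s \in P') ->
    (color s == color v) = (s \in P) /\
    (s = v \/ exists2 t : seat, (t \in O) (+) (t \in O') & neighbor t s).
  rewrite PE P'E eqxx; case: (boolP (_ && _)) => [/andP[svS nbs]|].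
    rewrite addTb negb_and negbK; case/orP => [nsS|/blockedP[t tO' nts]].
      by move: svS; rewrite !inE (negPf nsS) orbF => /eqP ->; rewrite eqxx; split; [|left].
    have tO : t \in O = false.
      by apply: contraNF nbs => tO; apply/blockedP; exists t.
    have tD : (t \in O) (+) (t \in O') by rewrite tO tO'.
    have := colorD t tD; rewrite tO (neighbor_color nts) => ct.
    split; last by right; exists t.
    by move: ct; case: (color s) (color v) => -[].
  rewrite addFb negb_and negbK => + /andP[sS nbs]; rewrite !inE sS orbT /=.
  case/blockedP=> t tO nts.
  have tO' : t \in O' = false.
    by apply: contraNF nbs => tO'; apply/blockedP; exists t.
  have tD : (t \in O) (+) (t \in O') by rewrite tO tO'.
  have := colorD t tD; rewrite tO (neighbor_color nts) => ct.
  split; last by right; exists t.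
  by move: ct; case: (color s) (color v) => -[].
have old t : (t \in O) (+) (t \in O') -> (t \in P) (+) (t \in P').
  by rewrite PE P'E; case: eqP => // ->; rewrite sO sO'.
(* [s] enters next to an old discrepancy, so its column is at most one further. *)
split=> [t|t c].
  have [->|ts] := eqVneq t s; first by move=> /new[].
  by rewrite PE P'E (negPf ts); apply: colorD.
have [->|ts] := eqVneq t s; last first.
  rewrite PE P'E (negPf ts) => tD /(columnsD _ _ tD)[u uD uc].
  by exists u => //; apply: old.
move=> sD; have [_ [sv|[u uD nus]]] := new sD => c_in.
  by exists s => //; move: c_in; rewrite sv => c_in; lia.
have [cs|cs] := eqVneq c s.2; first by exists s.
have [|w wD wc] := columnsD _ c uD; last by exists w => //; apply: old.
by move: nus c_in cs; rewrite neighborC => /neighbor_column; clear; lia.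
Qed.

(** A discrepancy that is not matched within its column is in the last column of the
discrepancy: what keeps the opposite seat empty is a seat occupied in both
processes, and its column is then free of discrepancies.  A missing opposite
seat is allowed only in the last column of [S]. *)
Lemma alternating_last v S O O' m d :
    {in S, forall t, v.2 <= t.2} ->
    {in S, forall s, opposite s \in v |` S \/ {in S, forall t, t.2 <= s.2}} ->
    greedy (v |` S) fset0 O -> greedy S fset0 O' -> alternating v O O' ->
    m \in O' -> m \notin O -> opposite m \notin O `\` O' ->
  (d \in O) (+) (d \in O') -> d.2 <= m.2.
Proof.
move=> first_col last_col gO gO' [colorD columnsD] mO' mO pD dD.
have first_col' t : t \in v |` S -> v.2 <= t.2.
  by rewrite !inE => /orP[/eqP ->|/first_col].
have D_vS t : (t \in O) (+) (t \in O') -> t \in v |` S.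
  case: (boolP (t \in O)) => [/(greedy_sub gO) //|_ /(greedy_sub gO')].
  by rewrite !inE => ->; rewrite orbT.
have mS := greedy_sub gO' mO'.
have mD : (m \in O) (+) (m \in O') by rewrite (negPf mO).
rewrite leNgt; apply/negP => m_d.
have pO' : opposite m \notin O'.
  by apply: contraL (neighbor_opposite m) => /(greedy_indep gO' mO').
have pO : opposite m \notin O by move: pD; rewrite inE pO'.
have pvS : opposite m \in v |` S.
  case: (last_col _ mS) => // le_m; have := D_vS _ dD.
  rewrite !inE => /orP[/eqP dv|/le_m]; last by rewrite leNgt m_d.
  by move: (first_col _ mS); rewrite -dv leNgt m_d.
have := greedy_max gO pvS; rewrite inE (negPf pO) /= => /(_ isT).
case/blockedP => q qO nqp.
(* [q] is occupied in both processes, since it has the wrong color to be in [O]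
   only. *)
have qO' : q \in O'.
  apply: contraTT mO => qO'; rewrite negbK.
  have := colorD q; rewrite qO (negPf qO') => /(_ isT).
  have := colorD m mD; rewrite (neighbor_color nqp) -(neighbor_color (neighbor_opposite m)).
  by move=> <-.
(* The discrepancy meets the column of [q], which lies between those of [v] and
   [d]; but a seat of that column is [q] or a neighbor of [q]. *)
have [|e eD eq] := columnsD d q.2 dD.
  rewrite (first_col' _ (greedy_sub gO qO)) /=.
  by move: (neighbor_column nqp) m_d => /=; clear; lia.
case: (same_column eq) eD => ->; first by rewrite qO qO'.
have -> : opposite q \in O = false.
  by apply: contraTF (neighbor_opposite q) => /(greedy_indep gO qO).
have -> // : opposite q \in O' = false.
by apply: contraTF (neighbor_opposite q) => /(greedy_indep gO' qO').
Qed.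

(** Matching each seat of [O' `\` O] with its opposite seat leaves out at most one,
namely [m].  If [v] has no opposite seat, it is matched with no seat and
can compensate for [m]. *)
Lemma card_alternating v S O O' :
    v \notin S ->
    {in S, forall t, v.2 <= t.2} ->
    {in S, forall s, opposite s \in v |` S \/ {in S, forall t, t.2 <= s.2}} ->
    greedy (v |` S) fset0 O -> greedy S fset0 O' -> alternating v O O' ->
  (#|` O'| <= #|` O| + (opposite v \in S))%N.
Proof.
move=> vS first_col last_col gO gO' alt.
rewrite -(cardfsID O O') -(cardfsID O' O) fsetIC -addnA leq_add2l.
have card_opposite (B : {fset seat}) : #|` [fset opposite s | s in B]| = #|` B|.
  by rewrite card_imfset //; apply: inv_inj oppositeK.
have [/existsP[[m mD] /= mbad]|nobad] :=
  boolP [exists m : O' `\` O, opposite (val m) \notin O `\` O'].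
  move: (mD); rewrite inE => /andP[mO mO'].
  have m_last d : (d \in O) (+) (d \in O') -> d.2 <= m.2.
    exact: alternating_last gO gO' alt mO' mO mbad.
  have good s : s \in (O' `\` O) `\ m -> opposite s \in O `\` O'.
    rewrite !inE => /andP[sm /andP[sO sO']]; apply: contraNT sm => sbad.
    have le_ms : m.2 <= s.2.
      apply: (alternating_last first_col last_col gO gO' alt sO' sO).
        by rewrite inE.
      by rewrite (negPf mO).
    have := m_last s; rewrite (negPf sO) sO' => /(_ isT) le_sm.
    have /same_column[-> //|sm] : s.2 = m.2 by apply/le_anti/andP.
    have := greedy_indep gO' mO' sO'; rewrite sm.
    by rewrite neighbor_opposite.
  rewrite (cardfsD1 m) mD -card_opposite addnC.
  case: (boolP (opposite v \in S)) => [_|fvS].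
    rewrite leq_add2r; apply/fsubset_leq_card/fsubsetP => _ /imfsetP[s /= /good sD ->] //.
  (* The interval of columns that meet the discrepancy starts at [v]. *)
  have [||e eD ev] := @alt_columns _ _ _ alt m v.2; first by rewrite (negPf mO).
    by rewrite lexx first_col ?(greedy_sub gO').
  have fv : opposite v != v by case: (v) => -[] c.
  have {}ev : e = v.
    case: (same_column ev) eD => // ->.
    case: (boolP (_ \in O)) => [/(greedy_sub gO)|_ /(greedy_sub gO')].
      by rewrite !inE (negPf fv) (negPf fvS).
    by rewrite (negPf fvS).
  have vD : v \in O `\` O'.
    have vO' : v \notin O' by apply: contra vS => /(greedy_sub gO').
    by move: eD; rewrite ev !inE (negPf vO') addbF.
  rewrite addn0 (cardfsD1 v (O `\` O')) vD addnC leq_add2l.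
  apply/fsubset_leq_card/fsubsetP => _ /imfsetP[s /= sD ->].
  rewrite in_fsetD1 good // andbT; apply: contraNneq fvS => <-.
  rewrite oppositeK; apply: (greedy_sub gO').
  by move: sD; rewrite !inE => /and3P[].
rewrite -card_opposite; apply: leq_trans (leq_addr _ _).
apply/fsubset_leq_card/fsubsetP => _ /imfsetP[s /= sD ->].
by move: nobad; rewrite negb_exists => /forallP/(_ [` sD]); rewrite negbK.
Qed.

Lemma cdf_mono (R : realFieldType) (X : finRV R) x y : x <= y -> cdf X x <= cdf X y.
Proof.
move=> xy; rewrite /cdf [leLHS]big_mkcond [leRHS]big_mkcond; apply: ler_sum => w _.
case: ifP => [Xx|_]; first by rewrite (le_trans Xx xy).
by case: ifP => // _; apply: prob_ge0.
Qed.

Lemma cdf_subc (R : realFieldType) (X : finRV R) a x : cdf (subc X a) x = cdf X (x + a).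
Proof. by apply: eq_bigl => w /=; rewrite lerBlDr. Qed.

(** The second hypothesis allows a gap next to a seat only where [v] fills it or in
the last column, which is where a parallelogram or a trapezoid has one. *)
Lemma dominates_add_first (R : realFieldType) v S :
    {in S, forall t, v.2 <= t.2} ->
    {in S, forall s, opposite s \in v |` S \/ {in S, forall t, t.2 <= s.2}} ->
  dominates (occupied R (v |` S)) (subc (occupied R S) (opposite v \in S)%:R).
Proof.
move=> first_col last_col x; rewrite cdf_subc.
have [vS|vS] := boolP (v \in S).
  by rewrite mem_fset1U // cdf_mono // lerDl ler0n.
have sub : S `<=` v |` S by apply: fsubsetU1.
rewrite (cdf_occupied_order _ (fsubset_refl _)) (cdf_occupied_order _ sub).
pose Inv O O' U := [/\ greedy (v |` S) U O, greedy S U O' & alternating v O O'].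
apply: (@order_cdf_dominates _ _ _ _ _ Inv).
- move=> O O' U s [gO gO' alt] sU.
  by split; [apply: greedy_step | apply: greedy_step | apply: alternating_step alt sU].
- by move=> O O' [gO gO' alt]; apply: card_alternating gO gO' alt.
- by split; [apply: greedy_start | apply: greedy_start | apply: alternating_start].
Qed.

(** * Symmetries of the ladder *)

Definition mirror s : seat := (s.1, - s.2).

Lemma mirrorK : involutive mirror.
Proof. by case=> r c; rewrite /mirror /= opprK. Qed.

Lemma mirror_neighbor : {mono mirror : s t / neighbor s t}.
Proof. by move=> s t; rewrite /neighbor /= (inj_eq (@oppr_inj int)) -opprD normrN. Qed.

Lemma dominates_add_last (R : realFieldType) v S :
    {in S, forall t, t.2 <= v.2} ->
    {in S, forall s, opposite s \in v |` S \/ {in S, forall t, s.2 <= t.2}} ->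
  dominates (occupied R (v |` S)) (subc (occupied R S) (opposite v \in S)%:R).
Proof.
move=> last_col first_col x; have mirror_inj := inv_inj mirrorK.
pose mS := [fset mirror s | s in S].
have mem_mS s : (mirror s \in mS) = (s \in S) by rewrite mem_imfset.
have mvS : [fset mirror s | s in v |` S] = mirror v |` mS.
  apply/fsetP => s; rewrite -[s]mirrorK mem_imfset //= !inE mem_mS.
  by rewrite (inj_eq mirror_inj).
have : dominates (occupied R (mirror v |` mS))
                 (subc (occupied R mS) (opposite (mirror v) \in mS)%:R).
  apply: dominates_add_first => s.
    by rewrite -[s]mirrorK mem_mS /= lerN2 => /last_col.
  rewrite -{1}[s]mirrorK mem_mS => /first_col[|first_s]; [left|right=> t].
    by rewrite -mvS -[opposite s]mirrorK mem_imfset.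
  by rewrite -{1}[t]mirrorK mem_mS => /first_s /=; rewrite lerN2.
move=> /(_ x); rewrite -mvS !cdf_subc !cdf_occupied_isometry //;
  try exact: mirror_neighbor.
by rewrite -[opposite (mirror v)]mirrorK mem_mS /opposite /mirror /= opprK.
Qed.

Definition shift s : seat := (s.1, s.2 + 1).

Lemma shift_inj : injective shift.
Proof. by case=> r c [r' c'] [-> /addIr ->]. Qed.

Lemma shift_neighbor : {mono shift : s t / neighbor s t}.
Proof. by move=> s t; rewrite /neighbor /= (inj_eq (addIr _)) opprD addrACA subrr addr0. Qed.

Lemma mem_row_seats r a b s :
  (s \in row_seats r a b) = (s.1 == r) && (a%:Z <= s.2 <= b%:Z).
Proof.
apply/imfsetP/andP => /= [[c]|[/eqP]].
  by rewrite mem_index_iota => cab ->; rewrite eqxx; split=> //=; lia.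
case: s => r' [c|c] /= -> cab; last by lia.
by exists c => //; rewrite mem_index_iota; lia.
Qed.

Lemma mem_shift s S : (s \in [fset shift t | t in S]) = ((s.1, s.2 - 1) \in S).
Proof.
have -> : s = shift (s.1, s.2 - 1) by case: s => r c; rewrite /shift /= subrK.
by rewrite mem_imfset //=; [rewrite addrK | exact: shift_inj].
Qed.

Definition mem_conf := (mem_row_seats, mem_shift, inE).

(** * The four comparisons *)

(** After [v] is added at one end, the column of [v] may have a gap; that is harmless
for adding [w], since this column is then the last one seen from [w]. *)
Lemma dominates_add_ends (R : realFieldType) (v w : seat) S b :
    {in S, forall t, v.2 <= t.2} ->
    {in S, forall s, opposite s \in v |` S \/ {in S, forall t, t.2 <= s.2}} ->
    {in v |` S, forall t, t.2 <= w.2} ->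
    {in v |` S, forall s, opposite s \in w |` (v |` S) \/
      {in v |` S, forall t, s.2 <= t.2}} ->
    ((opposite v \in S) + (opposite w \in v |` S) <= b)%N ->
  dominates (occupied R (w |` (v |` S))) (subc (occupied R S) b%:R).
Proof.
move=> vf vl wl wf vwb x.
apply: le_trans (dominates_add_last wl wf x) _; rewrite cdf_subc.
apply: le_trans (dominates_add_first vf vl _) _; rewrite !cdf_subc.
by rewrite cdf_mono // -addrA lerD2l -natrD ler_nat addnC.
Qed.

(** Membership in the configurations, and the conditions on their ends, are linear
arithmetic in the columns once the rows are fixed. *)
Ltac decide_seats :=
  rewrite /confX /confA /confB /opposite /top /bottom !mem_conf /= ?xpair_eqE;
  repeat match goal with r : bool |- _ => case: r => /= end;
  lia.

Ltac decide_ends :=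
  match goal with
  | |- {in _, forall s, _ \/ _} =>
      let s := fresh "s" in let sS := fresh "sS" in let nfs := fresh "nfs" in
      let t := fresh "t" in let tS := fresh "tS" in
      move=> s sS; case: (boolP (opposite s \in _)) => [|nfs]; [by left | right=> t tS];
      move: sS nfs tS; case: s => [? ?]; case: t => [? ?]
  | |- _ => case=> ? ?
  end; decide_seats.

Theorem theorem4 (R : realFieldType) (n : nat) (hn : (1 <= n)%N) :
  [/\ dominates (A_ R n.+1) (X_ R n),
      dominates (B_ R n.+1) (X_ R n),
      dominates (X_ R n) (subc (A_ R n.-1) 2)
    & dominates (X_ R n) (subc (B_ R n.-1) 2)].
Proof.
have subc0 (X Y : finRV R) : dominates X (subc Y 0%:R) -> dominates X Y.
  by move=> XY x; have := XY x; rewrite cdf_subc addr0.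
have unshift S b (X : finRV R) :
    dominates X (subc (occupied R [fset shift s | s in S]) b) ->
    dominates X (subc (occupied R S) b).
  move=> XS x; have := XS x; rewrite !cdf_subc cdf_occupied_isometry //.
    exact: shift_inj.
  exact: shift_neighbor.
split.
- (* Translated by one column, [X_n] lies inside [A_n+1]. *)
  have eqA : confA n.+1 =
      (bottom, n.+2%:Z) |` ((top, 1) |` [fset shift s | s in confX n]).
    apply/fsetP => -[r c]; decide_seats.
  rewrite /A_ eqA; apply/subc0/unshift/dominates_add_ends; try decide_ends.
  decide_seats.
- have eqB : confB n.+1 = (bottom, n.+1%:Z) |` ((bottom, 0) |` confX n).
    apply/fsetP => -[r c]; decide_seats.
  rewrite /B_ eqB; apply/subc0/dominates_add_ends; try decide_ends.
  decide_seats.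
- (* Each of the two added corners costs at most one seat. *)
  have eqX : confX n = (top, n%:Z) |` ((bottom, 1) |` confA n.-1).
    apply/fsetP => -[r c]; decide_seats.
  rewrite /X_ eqX; apply: dominates_add_ends (leq_add (leq_b1 _) (leq_b1 _)); decide_ends.
- (* For [n = 1] the two added seats coincide, so adding the second does
     nothing. *)
  have eqX : confX n = (top, n%:Z) |` ((top, 1) |` [fset shift s | s in confB n.-1]).
    apply/fsetP => -[r c]; decide_seats.
  rewrite /X_ eqX; apply: unshift.
  apply: dominates_add_ends (leq_add (leq_b1 _) (leq_b1 _)); decide_ends.
Qed.
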